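(* Let $N$ be a lattice of rank $d$ and $P\subset N_{\mathbb{R}}$ a $d$-dimensional lattice polytope containing the origin in its interior. For every rational $-1<k\le0$ there is a polynomial $F_k$ of degree at most $d$ with $F_k(m)=f^0_k(m)$ for all integers $m\ge0$, and for every positive integer $m$, \[F_k(-m)=\begin{cases}(-1)^dF_{-1-k}(m) & \text{if } -1<k<0,\\ (-1)^dF_k(m-1) & \text{if } k=0.\end{cases}\]
   Context: Let $\psi(v)=\min\{\mu\ge0: v\in\mu P\}$ for $v\in N_{\mathbb{R}}$ (so $P=\{\psi\le1\}$), and for $v\in N$ let $w_0(v)=\psi(v)-\lceil\psi(v)\rceil\in(-1,0]$. For rational $k$ and integer $m\ge0$, $f^0_k(m)$ is the number of $v\in mP\cap N$ with $w_0(v)=k$. *)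

(* Defs.v *)
From mathcomp Require Import all_boot all_order all_algebra finmap.
From mathcomp Require Import all_classical all_reals all_analysis.
Import Order.TTheory GRing.Theory Num.Theory numFieldNormedType.Exports.

Set Implicit Arguments.
Unset Strict Implicit.
Unset Printing Implicit Defensive.

Local Open Scope classical_set_scope.
Local Open Scope ring_scope.

Section Defs.
Context {R : realType} {d : nat}.
Implicit Types (N P : set 'rV[R]_d) (v : 'rV[R]_d) (k : rat) (m : nat).

(* A lattice of rank d is realized inside its real span N_R = R^d, as the
   integer combinations of the rows of an invertible matrix. *)
Definition is_lattice N :=
  exists2 B : 'M[R]_d, B \in unitmx &
    N = range (fun z : 'rV[int]_d => map_mx intr z *m B).

Definition conv_hull (s : seq 'rV[R]_d) : set 'rV[R]_d :=
  [set v | exists c : 'I_(size s) -> R,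
    [/\ forall i, 0 <= c i, \sum_i c i = 1 & v = \sum_i c i *: s`_i]].

Definition lattice_polytope N P :=
  exists2 s : seq 'rV[R]_d, [set` s] `<=` N & P = conv_hull s.

(* P contains d + 1 affinely independent points. *)
Definition full_dimensional P :=
  exists2 p, P p & exists2 B : 'M[R]_d, B \in unitmx &
    forall i, P (p + row i B).

Definition dilate (mu : R) P : set 'rV[R]_d := [set mu *: x | x in P].

(* S `&` lbound S is the set of minimum elements of S, a singleton as soon as
   the minimum exists; it does when P is a polytope with 0 in its interior. *)
Definition psi P v : R :=
  let S := [set mu : R | 0 <= mu /\ dilate mu P v] in
  xget 0 (S `&` lbound S).

Definition w0 P v : R := psi P v - (Num.ceil (psi P v))%:~R.

(* fset_set sends infinite sets to fset0; the set below is finite when N is a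
   lattice and P a polytope. *)
Definition f0 N P k m : nat :=
  #|` fset_set [set v | [/\ dilate m%:R P v, N v & w0 P v = ratr k]] |.

End Defs.

(* Main.v *)
(* Weight the i-th generator of P by 1 + t^(i+1) with t small: the cones over
   the optimal bases of the linear program "write v as a nonnegative combination
   of least weight" triangulate the space, and psi is linear on each of them.
   Moving every point slightly in a generic direction q makes this a partition
   into half-open cones; the direction -q gives the complementary half-open
   cones. In a half-open cone every lattice point is, uniquely, a point of the
   half-open fundamental parallelepiped plus a natural combination of the
   generators, so the points with psi(v) in {k, k+1, ..., k+m} are counted by a
   sum of binomial coefficients C(m+d-j, d), where x ranges over the
   parallelepiped and psi(x) = k+j. Reciprocity comes from the symmetry
   x |-> (sum of the generators) - x, which sends psi(x) to d - psi(x) and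
   exchanges the parallelepipeds of q and -q. *)

Require Import Defs.
From mathcomp Require Import all_boot all_order all_algebra all_fingroup finmap.
From mathcomp Require Import all_classical all_reals all_analysis.
From mathcomp Require Import ring lra zify.
Import Order.TTheory GRing.Theory Num.Theory numFieldNormedType.Exports.
Set Implicit Arguments.
Unset Strict Implicit.
Unset Printing Implicit Defensive.
Local Open Scope classical_set_scope.
Local Open Scope ring_scope.

(** * Optimal bases of a linear program *)

Section NearZero.
Context {R : realType}.

(** Factoring out the power of ['X] leaves a cofactor nonzero at 0, hence near 0 by continuity. *)
Lemma near0_horner_neq0 (p : {poly R}) : p != 0 ->
  \forall t \near 0^'+, p.[t] != 0.
Proof.
move=> p0; have [m [q rq ->]] := multiplicity_XsubC p 0.
rewrite p0 /= in rq.
have q0 : \forall t \near 0^'+, q.[t] != 0.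
  have : q.[t] @[t --> 0^'+] --> q.[0].
    by apply: cvg_at_right_filter; exact: continuous_horner.
  by move/cvgr_neq0; apply.
near=> t; rewrite hornerM horner_exp hornerXsubC subr0 mulf_neq0 //.
  by near: t.
by rewrite expf_neq0// gt_eqF.
Unshelve. all: by end_near. Qed.

Lemma near0_horner_lt0 (p : {poly R}) : p.[0] < 0 ->
  \forall t \near 0^'+, p.[t] < 0.
Proof.
move=> p0.
have : p.[t] @[t --> 0^'+] --> p.[0].
  by apply: cvg_at_right_filter; exact: continuous_horner.
by move/cvgr_lt; apply.
Qed.

End NearZero.

Section Bases.
Context {R : realType} {n d : nat}.
Variable S : 'M[R]_(n, d).
Implicit Types (f g : {ffun 'I_d -> 'I_n}) (y c : 'rV[R]_d) (w : 'I_n -> R).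

Definition basis f : 'M[R]_d := rowsub f S.

Lemma row_basis f i : row i (basis f) = row (f i) S.
Proof. by rewrite /basis row_rowsub. Qed.

Lemma mulmx_basis c f : c *m basis f = \sum_i c 0 i *: row (f i) S.
Proof. by rewrite mulmx_sum_row; apply: eq_bigr => i _; rewrite row_basis. Qed.

Definition coord f y : 'rV[R]_d := y *m invmx (basis f).

Lemma coordK f y : basis f \in unitmx -> coord f y *m basis f = y.
Proof. by move=> fu; rewrite /coord mulmxKV. Qed.

Lemma coord_eq f y c : basis f \in unitmx -> c *m basis f = y -> coord f y = c.
Proof. by move=> fu <-; rewrite /coord mulmxK. Qed.

Definition cost w f y : R := \sum_i coord f y 0 i * w (f i).

Lemma coordD f y z : coord f (y + z) = coord f y + coord f z.
Proof. by rewrite /coord mulmxDl. Qed.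

Lemma coordB f y z : coord f (y - z) = coord f y - coord f z.
Proof. by rewrite /coord mulmxBl. Qed.

Lemma coordZ f a y : coord f (a *: y) = a *: coord f y.
Proof. by rewrite /coord scalemxAl. Qed.

Lemma costD w f y z : cost w f (y + z) = cost w f y + cost w f z.
Proof. by rewrite /cost -big_split/=; apply: eq_bigr => i _; rewrite coordD mxE mulrDl. Qed.

Lemma costB w f y z : cost w f (y - z) = cost w f y - cost w f z.
Proof. by rewrite /cost -sumrB; apply: eq_bigr => i _; rewrite coordB !mxE mulrBl. Qed.

Lemma costZ w f a y : cost w f (a *: y) = a * cost w f y.
Proof. by rewrite /cost mulr_sumr; apply: eq_bigr => i _; rewrite coordZ mxE mulrA. Qed.

Lemma cost_sum w f (I : Type) (r : seq I) (P : pred I) (F : I -> 'rV[R]_d) :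
  cost w f (\sum_(i <- r | P i) F i) = \sum_(i <- r | P i) cost w f (F i).
Proof.
elim/big_rec2: _ => [|i x y _ <-]; last exact: costD.
by rewrite -[0](scale0r 0) costZ mul0r.
Qed.

Lemma coord_basis f i : basis f \in unitmx -> coord f (row (f i) S) = delta_mx 0 i.
Proof. by move=> fu; apply: coord_eq => //; rewrite -rowE row_basis. Qed.

Lemma cost_basis w f i : basis f \in unitmx -> cost w f (row (f i) S) = w (f i).
Proof.
move=> fu; rewrite /cost coord_basis// (bigD1 i)//= mxE !eqxx mul1r big1 ?addr0//.
by move=> j ji; rewrite mxE (negbTE ji) andbF mul0r.
Qed.

Lemma basis_inj f : basis f \in unitmx -> injective f.
Proof.
move=> fu i j fij; have := coord_basis i fu.
rewrite fij coord_basis// => /rowP /(_ i).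
by rewrite !mxE !eqxx/=; case: eqVneq => // _ /eqP; rewrite eq_sym oner_eq0.
Qed.

(* [cost w f] is the linear form taking the value [w (f i)] at the i-th basis
   vector, so this is feasibility of the dual linear program. *)
Definition dual_feasible w f :=
  (basis f \in unitmx) && [forall j, cost w f (row j S) <= w j].

Definition in_cone f y := [forall i, 0 < coord f y 0 i].

(** Dual nondegeneracy: it makes the optimal basis whose open cone contains a given point unique up
    to order. *)
Definition tie_free w := forall f j, basis f \in unitmx ->
  cost w f (row j S) = w j -> exists i, j = f i.

(** Primal nondegeneracy: [y] avoids the facet hyperplanes of all simplicial cones on the
    generators. *)
Definition generic y := forall f i, basis f \in unitmx -> coord f y 0 i != 0.

(** Weak duality: expand [y] in the basis [g] and bound the linear form [cost w f] by [w] on each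
    generator. *)
Lemma cost_le w f g y : dual_feasible w f -> basis g \in unitmx ->
  (forall i, 0 <= coord g y 0 i) -> cost w f y <= cost w g y.
Proof.
move=> /andP[fu /forallP fw] gu gy.
rewrite -{1}(coordK y gu) mulmx_basis cost_sum; apply: ler_sum => i _.
by rewrite costZ ler_wpM2l.
Qed.

(** Complementary slackness: weak duality both ways equates the two costs of [y], so the products of
    coordinate and slack sum to zero. The coordinates are positive, hence every slack vanishes and
    [tie_free] applies. *)
Lemma cone_unique w f g y : tie_free w -> dual_feasible w f ->
  dual_feasible w g -> in_cone f y -> in_cone g y ->
  forall i, exists j, g i = f j.
Proof.
move=> wtf fw gw /forallP fy /forallP gy i.
have [fu gu] : basis f \in unitmx /\ basis g \in unitmx.
  by case/andP: fw; case/andP: gw.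
have fg : cost w f y = cost w g y.
  by apply/eqP; rewrite eq_le !cost_le// => k; apply: ltW.
apply: wtf fu _.
move/andP: (fw) => [_ /forallP fw'].
have sum0 : \sum_k coord g y 0 k * (w (g k) - cost w f (row (g k) S)) = 0.
  apply: etrans (_ : cost w g y - cost w f y = 0); last by rewrite fg subrr.
  rewrite -{3}(coordK y gu) mulmx_basis cost_sum -sumrB.
  by apply: eq_bigr => k _; rewrite costZ mulrBr.
have term_ge0 k : true -> 0 <= coord g y 0 k * (w (g k) - cost w f (row (g k) S)).
  by move=> _; rewrite mulr_ge0 ?subr_ge0// ltW.
have /eqP := psumr_eq0P term_ge0 sum0 (i:=i) isT.
by rewrite mulf_eq0 gt_eqF//= subr_eq0 => /eqP ->.
Qed.

Definition permute_basis f (s : 'S_d) : {ffun 'I_d -> 'I_n} := [ffun i => f (s i)].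

Lemma permute_basis_unit f s :
  (basis (permute_basis f s) \in unitmx) = (basis f \in unitmx).
Proof.
have -> : basis (permute_basis f s) = perm_mx s *m basis f.
  by rewrite -row_permE; apply/matrixP => i j; rewrite !mxE ffunE.
by rewrite unitmx_mul unitmx_perm.
Qed.

Lemma coord_permute f s y i : basis f \in unitmx ->
  coord (permute_basis f s) y 0 i = coord f y 0 (s i).
Proof.
move=> fu; rewrite (@coord_eq _ _ (\row_j coord f y 0 (s j))) ?mxE//.
  by rewrite permute_basis_unit.
rewrite mulmx_basis -[RHS](coordK y fu) mulmx_basis [RHS](reindex_inj (@perm_inj _ s)).
by apply: eq_bigr => j _; rewrite mxE ffunE.
Qed.

Lemma dual_feasible_permute w f s : dual_feasible w f ->
  dual_feasible w (permute_basis f s).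
Proof.
move=> /andP[fu /forallP fw]; apply/andP; split; first by rewrite permute_basis_unit.
apply/forallP => j; apply: le_trans (fw j).
rewrite /cost [leRHS](reindex_inj (@perm_inj _ s)) le_eqVlt; apply/orP; left.
by apply/eqP; apply: eq_bigr => i _; rewrite coord_permute// ffunE.
Qed.

(** Bases are ordered tuples: by [cone_unique] those containing [y] are the reorderings of a single
    one, and these are distinct because a basis is injective. *)
Lemma card_cones w y : tie_free w ->
  (exists f, dual_feasible w f && in_cone f y) ->
  (\sum_(f | dual_feasible w f) in_cone f y)%N = d`!.
Proof.
move=> wtf [f /andP[fw fy]].
have fu : basis f \in unitmx by case/andP: fw.
have inj_perm : injective (permute_basis f).
  move=> s t st; apply/permP => i; apply: (basis_inj fu).
  by have /ffunP/(_ i) := st; rewrite !ffunE.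
transitivity #|[pred f | dual_feasible w f && in_cone f y]|.
  rewrite -sum1_card [LHS]big_mkcond [RHS]big_mkcond; apply: eq_bigr => g _.
  by rewrite inE/=; case: dual_feasible; case: in_cone.
rewrite -card_Sn -(card_codom inj_perm).
apply: eq_card => g; rewrite !inE; apply/idP/codomP => [/andP[gw gy]|[s ->]].
  have gu : basis g \in unitmx by case/andP: gw.
  have /choice[s sE] := cone_unique wtf fw gw fy gy.
  have s_inj : injective s.
    by move=> i j ij; apply: (basis_inj gu); rewrite !sE ij.
  by exists (perm s_inj); apply/ffunP => i; rewrite ffunE permE.
rewrite dual_feasible_permute//=; apply/forallP => i.
by rewrite coord_permute//; move/forallP: fy.
Qed.

Definition pivot f i0 j : {ffun 'I_d -> 'I_n} := [ffun i => if i == i0 then j else f i].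

Lemma pivot_sum f i0 j c : basis f \in unitmx ->
  c *m basis (pivot f i0 j) =
  (c + c 0 i0 *: (coord f (row j S) - delta_mx 0 i0)) *m basis f.
Proof.
move=> fu; rewrite mulmxDl -scalemxAl mulmxBl coordK// -rowE row_basis.
rewrite !mulmx_basis (bigD1 i0)//= [in RHS](bigD1 i0)//= ffunE eqxx scalerBr.
rewrite [RHS]addrC [RHS]addrA subrK; congr (_ + _).
by apply: eq_bigr => i /negbTE i0i; rewrite ffunE i0i.
Qed.

Lemma pivot_coordE c (l : 'rV[R]_d) a i0 i :
  (c + a *: (l - delta_mx 0 i0)) 0 i = c 0 i + a * (l 0 i - (i == i0)%:R).
Proof. by rewrite !mxE. Qed.

Lemma pivot_unit f i0 j : basis f \in unitmx -> coord f (row j S) 0 i0 != 0 ->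
  basis (pivot f i0 j) \in unitmx.
Proof.
move=> fu j0; rewrite -row_free_unit; apply: inj_row_free => c.
rewrite pivot_sum// => c0.
have {c0} : c + c 0 i0 *: (coord f (row j S) - delta_mx 0 i0) = 0.
  by rewrite -[LHS](mulmxK fu) c0 mul0mx.
move=> c0; have : c 0 i0 = 0.
  move/rowP: c0 => /(_ i0); rewrite pivot_coordE eqxx [RHS]mxE => /eqP.
  by rewrite mulrBr mulr1 addrC subrK mulf_eq0 (negbTE j0) orbF => /eqP.
by move: c0 => /[swap] ->; rewrite scale0r addr0.
Qed.

(** A step of the simplex method: if a basis of least cost among those whose cone contains [y]
    violated a dual constraint, pivoting in the violating generator would keep [y] in the cone and
    lower the cost. *)
Lemma cone_exists w y : (forall j, 0 < w j) -> generic y ->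
  (exists f, (basis f \in unitmx) && in_cone f y) ->
  exists f, dual_feasible w f && in_cone f y.
Proof.
move=> w0 yg [f0 fu0].
have [f /andP[fu /forallP fy] fmin] := @arg_minP _ _ _ f0
  (fun f => (basis f \in unitmx) && in_cone f y) (cost w ^~ y) fu0.
exists f; rewrite /dual_feasible fu/=; apply/andP; split; last exact/forallP.
apply/forallP => j; rewrite leNgt; apply/negP => wj.
pose l := coord f (row j S).
(* The weights are positive and [cost w f (row j S) > w j > 0], so some coordinate must be
   positive. *)
have [i1 li1] : exists i, 0 < l 0 i.
  apply/existsP; apply: contraT => /existsPn l0.
  have := lt_trans (w0 j) wj; rewrite ltNge => /negP[].
  apply: sumr_le0 => i _; apply: mulr_le0_ge0; last exact: ltW.
  by rewrite leNgt; apply: l0.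
(* Ratio test: letting the index of least ratio leave keeps the new coordinates nonnegative;
   genericity of [y] then makes them positive. *)
have [i0 li0 imin] := @arg_minP _ _ _ i1
  (fun i => 0 < l 0 i) (fun i => coord f y 0 i / l 0 i) li1.
pose t := coord f y 0 i0 / l 0 i0.
have t0 : 0 < t by rewrite divr_gt0.
pose c := coord f y + (- t) *: (l - delta_mx 0 i0).
have cE i : c 0 i = coord f y 0 i - t * (l 0 i - (i == i0)%:R).
  by rewrite /c pivot_coordE mulNr.
have ci0 : c 0 i0 = t by rewrite cE eqxx mulrBr mulr1 {1}/t divfK ?gt_eqF// subKr.
have gu : basis (pivot f i0 j) \in unitmx by rewrite pivot_unit// gt_eqF.
have gc : coord (pivot f i0 j) y = c.
  by apply: coord_eq => //; rewrite pivot_sum// ci0 -/l /c scaleNr subrK coordK.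
have gy : in_cone (pivot f i0 j) y.
  apply/forallP => i; rewrite lt_neqAle eq_sym yg//= gc.
  have [->|ii0] := eqVneq i i0; first by rewrite ci0 ltW.
  rewrite cE (negbTE ii0) subr0 subr_ge0.
  have [li|li] := ltP 0 (l 0 i).
    by rewrite -ler_pdivlMr// imin.
  by apply: le_trans (ltW (fy i)); rewrite mulr_ge0_le0// ltW.
have := fmin (pivot f i0 j); rewrite gu gy => /(_ isT).
rewrite leNgt => /negP; apply.
(* The cost changes by [t * (w j - cost w f (row j S))], which is negative. *)
have -> : cost w (pivot f i0 j) y =
    \sum_i c 0 i * w (f i) + t * (w j - w (f i0)).
  rewrite /cost gc (bigD1 i0)//= [in RHS](bigD1 i0)//= ffunE eqxx ci0.
  rewrite [RHS]addrAC -mulrDr addrCA subrr addr0; congr (_ + _).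
  by apply: eq_bigr => i /negbTE ii0; rewrite ffunE ii0.
have -> : \sum_i c 0 i * w (f i) =
    cost w f (y + (- t) *: (row j S - row (f i0) S)).
  by rewrite /cost coordD coordZ coordB coord_basis.
rewrite costD costZ costB cost_basis//.
have : 0 < t * (cost w f (row j S) - w j) by rewrite mulr_gt0// subr_gt0.
lra.
Qed.
End Bases.

(** * Generic weights, generic directions and the partition into half-open cones *)

Section Cover.
Context {R : realType} {n d : nat}.
Variable S : 'M[R]_(n, d).
Implicit Types (f g : {ffun 'I_d -> 'I_n}) (y q v : 'rV[R]_d) (w : 'I_n -> R).

(* The perturbation [1 + t ^ (j + 1)] of the weight [1] breaks all ties: it is
   what makes the optimal cones of the linear program a triangulation. *)
Lemma exists_tie_free_weights : exists w,
  [/\ forall j, 0 < w j, tie_free S w &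
      forall f, dual_feasible S w f -> dual_feasible S (fun=> 1) f].
Proof.
pose W (j : 'I_n) : {poly R} := 1 + 'X^(j.+1).
pose p f j := W j - \sum_i coord S f (row j S) 0 i *: W (f i).
have pE f j t : (p f j).[t] = (W j).[t] - cost S (fun k => (W k).[t]) f (row j S).
  rewrite hornerD hornerN horner_sum; congr (_ - _).
  by apply: eq_bigr => i _; rewrite hornerZ.
(* The exponent [j.+1] is special to [W j], so its coefficient in [p f j] is 1 when [j] is outside
   the basis. *)
have p_neq0 f j : ~~ [exists i, j == f i] -> p f j != 0.
  move=> /existsPn jf; apply/eqP => /polyP/(_ j.+1) /eqP.
  rewrite coefB coef_sum big1 => [|i _].
    by rewrite subr0 coefD coef1 coefXn eqxx coef0 add0r oner_eq0.
  have := jf i; rewrite -val_eqE coefZ coefD coef1 coefXn eqSS => /negbTE /= ->.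
  by rewrite addr0 mulr0.
have W0 j : (W j).[0] = 1 by rewrite hornerD hornerC hornerXn expr0n addr0.
have tie : \forall t \near (0 : R)^'+, forall f j,
    ~~ [exists i, j == f i] -> (p f j).[t] != 0.
  apply: filter_forall => f; apply: filter_forall => j.
  have [jf|jf] := boolP [exists i, j == f i]; first exact: nearW.
  by apply: filterS (near0_horner_neq0 (p_neq0 _ _ jf)) => t.
(* At [t = 0] all weights are 1: a constraint violated for the weight 1 stays violated for small
   [t], and the contrapositive gives the last property. *)
have feas : \forall t \near (0 : R)^'+, forall f j,
    (p f j).[0] < 0 -> (p f j).[t] < 0.
  apply: filter_forall => f; apply: filter_forall => j.
  have [pf|pf] := boolP ((p f j).[0] < 0); last exact: nearW.
  by apply: filterS (near0_horner_lt0 pf).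
have : \forall t \near (0 : R)^'+, exists w,
  [/\ forall j, 0 < w j, tie_free S w &
      forall f, dual_feasible S w f -> dual_feasible S (fun=> 1) f].
  near=> t; exists (fun j => (W j).[t]); split => [j|f j _ ft|f /andP[fu /forallP fw]].
  - by rewrite hornerD hornerC hornerXn addr_gt0// exprn_gt0.
  - have [/existsP[i /eqP]|jf] := boolP [exists i, j == f i]; first by exists i.
    have : (p f j).[t] != 0 by move: f j jf {ft}; near: t.
    by rewrite pE ft subrr eqxx.
  - rewrite /dual_feasible fu; apply/forallP => j; rewrite leNgt; apply/negP => fj.
    have : (p f j).[t] < 0.
      have : (p f j).[0] < 0; last by move: f j {fu fw fj}; near: t.
      rewrite pE W0 subr_lt0; apply: lt_le_trans fj _.
      by rewrite le_eqVlt; apply/orP/or_introl/eqP/eq_bigr => i _; rewrite W0.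
    by rewrite pE subr_lt0 ltNge fw.
by move=> /filter_ex[t].
Unshelve. all: by end_near. Qed.

(** On the moment curve each coordinate is a polynomial in [t], nonzero because its coefficients
    form a column of an invertible matrix; finitely many such polynomials have a common non-root. *)
Lemma exists_generic : exists q, generic S q.
Proof.
have : \forall t \near (0 : R)^'+, generic S (\row_j t ^+ j).
  suff : \forall t \near (0 : R)^'+, forall f i, basis S f \in unitmx ->
     coord S f (\row_j t ^+ j) 0 i != 0 by [].
  apply: filter_forall => f; apply: filter_forall => i.
  have [fu|fu] := boolP (basis S f \in unitmx); last exact: nearW.
  pose p := \sum_(j < d) invmx (basis S f) j i *: 'X^j.
  have p0 : p != 0.
    apply/eqP => /polyP p0; have := mulmxV fu.
    move=> /matrixP/(_ i i); rewrite !mxE eqxx big1 => [/eqP|j _].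
      by rewrite eq_sym oner_eq0.
    have := p0 j; rewrite coef0 coef_sum (bigD1 j)//= coefZ coefXn eqxx mulr1.
    rewrite big1 ?addr0 => [->|k kj]; first by rewrite mulr0.
    by rewrite coefZ coefXn eq_sym (inj_eq val_inj) (negbTE kj) mulr0.
  apply: filterS (near0_horner_neq0 p0) => t pt _.
  suff -> : coord S f (\row_j t ^+ j) 0 i = p.[t] by [].
  rewrite mxE horner_sum; apply: eq_bigr => j _.
  by rewrite mxE hornerZ hornerXn mulrC.
by move=> /filter_ex[t tg]; exists (\row_j t ^+ j).
Qed.

(* For [c i := 0 < coord S q i] with q generic, v belongs to this half-open cone
   iff [v + e *: q] is in the open cone for all small e > 0. *)
Definition half_open f (c : 'I_d -> bool) v :=
  [forall i, 0 < coord S f v 0 i ?<= if c i].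

(** A nonzero [a] keeps its sign under a small perturbation; when [a = 0] the sign of [b]
    decides. *)
Lemma near0_sign (a b : R) : b != 0 ->
  \forall e \near (0 : R)^'+, a + e * b != 0 /\
    (0 < a + e * b) = (0 < a ?<= if (0 < b)).
Proof.
move=> b0; pose p := a%:P + b *: 'X.
have pE e : p.[e] = a + e * b by rewrite hornerD hornerC hornerZ hornerX mulrC.
have p_neq0 : p != 0.
  apply/eqP => /polyP/(_ 1%N) /eqP.
  by rewrite coefD coefC coefZ coefX mulr1 coef0 add0r (negbTE b0).
have := near0_horner_neq0 p_neq0.
have [a0|a0|a0] := ltgtP 0 a.
- have : (- p).[0] < 0 by rewrite hornerN pE mul0r addr0 oppr_lt0.
  move=> /near0_horner_lt0; apply: filterS2 => e.
  rewrite hornerN pE oppr_lt0 => -> ->; split => //.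
  by case: (0 < b) => /=; rewrite ?a0 ?ltW.
- have : p.[0] < 0 by rewrite pE mul0r addr0.
  move=> /near0_horner_lt0; apply: filterS2 => e.
  rewrite pE => ea ->; split => //; rewrite ltNge ltW//=.
  by apply/esym/negbTE; case: (0 < b) => /=; rewrite -?ltNge -?leNgt// ltW.
- move=> pne; near=> e; split; first by rewrite -pE; near: e.
  rewrite -a0 add0r pmulr_rgt0//; case: (0 < b) => /=; rewrite ?lexx ?ltxx//.
Unshelve. all: by end_near. Qed.

(* The factorial counts the orderings of the generators of the unique cone. *)
Lemma card_half_open w q v : (forall j, 0 < w j) -> tie_free S w -> generic S q ->
  (forall y, exists2 f, basis S f \in unitmx & forall i, 0 <= coord S f y 0 i) ->
  (\sum_(f | dual_feasible S w f) half_open f (fun i => 0 < coord S f q 0 i)%R v)%N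
  = d`!.
Proof.
move=> w0 wtf qg span.
(* A single [e] serves the finitely many bases, which reduces the half-open cones at [v] to the open
   cones at [v + e *: q]. *)
have : \forall e \near (0 : R)^'+, forall f i, basis S f \in unitmx ->
    coord S f (v + e *: q) 0 i != 0 /\
    (0 < coord S f (v + e *: q) 0 i) =
    (0 < coord S f v 0 i ?<= if (0 < coord S f q 0 i)).
  apply: filter_forall => f; apply: filter_forall => i.
  have [fu|fu] := boolP (basis S f \in unitmx); last exact: nearW.
  apply: filterS (near0_sign (coord S f v 0 i) (qg f i fu)) => e + _.
  suff -> : coord S f (v + e *: q) 0 i =
    coord S f v 0 i + e * coord S f q 0 i by [].
  by rewrite coordD coordZ !mxE.
move=> /filter_ex[e He].
have yg : generic S (v + e *: q) by move=> f i fu; have [] := He f i fu.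
have [f0 fu0 f0_ge0] := span (v + e *: q).
have [] := cone_exists w0 yg.
  exists f0; rewrite fu0; apply/forallP => i.
  by rewrite lt_neqAle eq_sym yg// f0_ge0.
move=> f fP; rewrite -(card_cones wtf (ex_intro _ f fP)).
apply: eq_bigr => g /andP[gu _]; congr nat_of_bool.
by apply: eq_forallb => i; have [_ <-] := He g i gu.
Qed.
End Cover.

(** * The gauge psi on an optimal cone *)

Section ConvHull.
Context {R : realType} {d : nat}.
Variable s : seq 'rV[R]_d.
Local Notation P := (conv_hull s).

Lemma conv_hull_nth (k : 'I_(size s)) : P s`_k.
Proof.
exists (fun i => (i == k)%:R); split => [i||].
- by rewrite ler0n.
- by rewrite (bigD1 k)//= eqxx big1 ?addr0// => i /negbTE ->.
- rewrite (bigD1 k)//= eqxx scale1r big1 ?addr0// => i /negbTE ->.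
  by rewrite scale0r.
Qed.

Lemma conv_hull_sum (I : finType) (a : I -> R) (x : I -> 'rV[R]_d) :
  (forall i, 0 <= a i) -> \sum_i a i = 1 -> (forall i, P (x i)) ->
  P (\sum_i a i *: x i).
Proof.
move=> a0 a1 /choice[c xc].
exists (fun k => \sum_i a i * c i k); split => [k||].
- by apply: sumr_ge0 => i _; rewrite mulr_ge0//; have [+ _ _] := xc i; apply.
- rewrite exchange_big/= -[RHS]a1; apply: eq_bigr => i _.
  by rewrite -mulr_sumr; have [_ -> _] := xc i; rewrite mulr1.
- under [RHS]eq_bigr do rewrite scaler_suml.
  rewrite [RHS]exchange_big/=; apply: eq_bigr => i _.
  have [_ _ {1}->] := xc i; rewrite scaler_sumr.
  by apply: eq_bigr => k _; rewrite scalerA.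
Qed.

Lemma dilate_conv_hull_le (mu nu : R) v : P 0 -> 0 <= mu -> mu <= nu ->
  dilate mu P v -> dilate nu P v.
Proof.
move=> P0 mu0 munu [x Px <-].
have [nu0|nu0] := eqVneq nu 0.
  by exists x => //; have -> : mu = nu by apply/eqP; rewrite eq_le munu nu0.
exists ((mu / nu) *: x); last by rewrite scalerA mulrC divfK.
(* The rescaled point is a convex combination of [x] and the origin. *)
pose a (b : bool) := if b then mu / nu else 1 - mu / nu.
pose y (b : bool) : 'rV[R]_d := if b then x else 0.
have nu_gt0 : 0 < nu by rewrite lt_neqAle eq_sym nu0 (le_trans mu0).
have -> : (mu / nu) *: x = \sum_b a b *: y b.
  by rewrite big_bool/= scaler0 addr0.
apply: conv_hull_sum => [[]||[]] //=.
- by rewrite divr_ge0// ltW.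
- by rewrite subr_ge0 ler_pdivrMr// mul1r.
- by rewrite big_bool/= addrC subrK.
Qed.

Lemma conv_hull_ball : P° 0 -> exists2 delta : R, 0 < delta &
  forall i, P (delta *: delta_mx 0 i) /\ P (- (delta *: delta_mx 0 i)).
Proof.
move=> /nbhs_ballP[e /= e0 eP]; exists (e / 2); first by rewrite divr_gt0.
have he : `|e / 2| < e by rewrite gtr0_norm ?divr_gt0// gtr_pMr// invf_lt1// ltr1n.
move=> i; split; (apply: eP; split => //= j k); rewrite /ball/= !mxE sub0r ?opprK ?normrN.
  by case: (_ && _); rewrite ?mulr1// mulr0 normr0.
by case: (_ && _); rewrite ?mulr1// mulr0 normr0.
Qed.

End ConvHull.

Lemma row_scalar {R : pzRingType} {d : nat} (a : R) (i : 'I_d) :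
  row i a%:M = a *: delta_mx 0 i.
Proof. by rewrite -scalemx1 linearZ/= row1. Qed.

Section Vertices.
Context {R : realType} {d : nat}.
Variable s : seq 'rV[R]_d.
Variable delta : R.
Hypothesis delta_gt0 : 0 < delta.
Local Notation P := (conv_hull s).
Hypothesis P0 : P 0.
(* The factor 2 keeps the vectors [delta *: e_i] off the boundary of P, so that
   they belong to no optimal cone: they only provide a feasible starting cone. *)
Hypothesis deltaP : forall i, P ((2 * delta) *: delta_mx 0 i) /\
  P (- ((2 * delta) *: delta_mx 0 i)).

Definition generators : 'M[R]_(size s + (d + d), d) :=
  col_mx (\matrix_(i < size s) s`_i) (col_mx delta%:M (- delta)%:M).
Local Notation S := generators.
Implicit Types (f : {ffun 'I_d -> 'I_(size s + (d + d))}) (v : 'rV[R]_d).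

Definition height f v : R := \sum_i coord S f v 0 i.

Lemma heightE f v : height f v = cost S (fun=> 1) f v.
Proof. by apply: eq_bigr => i _; rewrite mulr1. Qed.

Lemma row_generators k : row (lshift (d + d) k) S = s`_k.
Proof. by rewrite rowKu rowK. Qed.

Lemma height_conv f x : dual_feasible S (fun=> 1) f -> P x -> height f x <= 1.
Proof.
move=> /andP[fu /forallP f1] [c [c0 c1 ->]]; rewrite heightE cost_sum -[leRHS]c1.
apply: ler_sum => k _; rewrite costZ -[leRHS]mulr1 ler_wpM2l//.
by rewrite -row_generators.
Qed.

(** A basis vector has height 1, whereas an auxiliary vector has its double in P and hence height at
    most 1/2. *)
Lemma feasible_vertex f i : dual_feasible S (fun=> 1) f ->
  exists k : 'I_(size s), row (f i) S = s`_k.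
Proof.
move=> fP; have fu : basis S f \in unitmx by case/andP: fP.
have fi : height f (row (f i) S) = 1 by rewrite heightE cost_basis.
have no k (e : 'rV_d) : P (2 *: e) -> row k S = e -> f i = k -> False.
  move=> /(height_conv fP); rewrite heightE costZ -heightE => + ke fk.
  by rewrite -ke -fk fi mulr1 lern1.
case: (split_ordP (f i)) => j fj; first by exists j; rewrite fj row_generators.
case: (split_ordP j) => k jk; exfalso; have [P1 P2] := deltaP k.
  apply: (no _ (delta *: delta_mx 0 k) _ _ fj); first by rewrite scalerA.
  by rewrite rowKd jk rowKu row_scalar.
apply: (no _ (- (delta *: delta_mx 0 k)) _ _ fj); first by rewrite scalerN scalerA.
by rewrite rowKd jk rowKd row_scalar scaleNr.
Qed.

Lemma height_cone_dilate f v : dual_feasible S (fun=> 1) f ->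
  (forall i, 0 <= coord S f v 0 i) -> dilate (height f v) P v.
Proof.
move=> fP fv; have fu : basis S f \in unitmx by case/andP: fP.
have hv : 0 <= height f v by apply: sumr_ge0 => i _.
(* Height zero forces [v = 0]; otherwise [v] divided by its height is a convex combination of points
   of [s]. *)
have [h0|h0] := eqVneq (height f v) 0.
  exists 0 => //; rewrite scaler0 -(coordK v fu).
  suff -> : coord S f v = 0 by rewrite mul0mx.
  by apply/rowP => i; rewrite [RHS]mxE; apply: (psumr_eq0P _ h0).
exists ((height f v)^-1 *: v); last by rewrite scalerA mulfV ?scale1r.
rewrite -{2}(coordK v fu) mulmx_basis scaler_sumr.
under eq_bigr do rewrite scalerA.
apply: conv_hull_sum => [i||i].
- by rewrite mulr_ge0// invr_ge0.
- by rewrite -mulr_sumr mulVf.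
- by have [k ->] := feasible_vertex i fP; exact: conv_hull_nth.
Qed.

Lemma dilate_height f mu v : dual_feasible S (fun=> 1) f -> 0 <= mu ->
  dilate mu P v -> height f v <= mu.
Proof.
move=> fP mu0 [x Px <-]; rewrite heightE costZ -heightE -[leRHS]mulr1.
by rewrite ler_wpM2l// height_conv.
Qed.

(** The height is an admissible dilation factor because the basis consists of points of P, and a
    lower bound because it is at most 1 on P. *)
Lemma psi_cone f v : dual_feasible S (fun=> 1) f ->
  (forall i, 0 <= coord S f v 0 i) -> psi P v = height f v.
Proof.
move=> fP fv.
have hmem : 0 <= height f v /\ dilate (height f v) P v.
  by split; [apply: sumr_ge0 | exact: height_cone_dilate].
have hlb : lbound [set mu | 0 <= mu /\ dilate mu P v] (height f v).
  by move=> mu [mu0]; exact: dilate_height.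
apply: xget_unique; first by split.
by move=> mu [muS mulb]; apply/eqP; rewrite eq_le hlb//= andbT mulb.
Qed.

(** For [-1 < k <= 0] the ceiling of [k + i] is [i], so [i] is the ceiling of [psi], and it is at
    most [m] exactly when [psi] is. *)
Lemma dilate_w0_cone f v k m : dual_feasible S (fun=> 1) f ->
  (forall i, 0 <= coord S f v 0 i) -> -1 < k <= 0 ->
  dilate m%:R P v /\ w0 P v = ratr k <->
  exists2 i, (i <= m)%N & height f v = ratr k + i%:R.
Proof.
move=> fP fv /andP[k1 k0]; rewrite /w0 (psi_cone fP fv).
have hv : 0 <= height f v by apply: sumr_ge0.
have {}k1 : -1 < ratr k :> R by rewrite -(ltr_rat R) rmorphN1 in k1.
have {}k0 : ratr k <= 0 :> R by rewrite -(ler_rat R) rmorph0 in k0.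
split=> [[vm hk]|[i im hi]].
  have cm : Num.ceil (height f v) <= m%:Z.
    by rewrite ceil_le_int dilate_height.
  have : 0 <= Num.ceil (height f v) by rewrite ceil_ge0 (lt_le_trans _ hv)// ltrN10.
  move: cm hk; case: (Num.ceil _) => // i im hk _.
  by exists i => //; rewrite -hk subrK.
have -> : Num.ceil (height f v) = i%:Z.
  apply: ceil_def; rewrite hi; apply/andP; split.
    by rewrite intrB -[i%:~R]/(i%:R) [ltRHS]addrC ltrD2l.
  by rewrite gerDr.
split; last by rewrite hi addrK.
apply: dilate_conv_hull_le (height_cone_dilate fP fv) => //.
by rewrite hi ler_wnDl// ler_nat.
Qed.

(** The auxiliary vectors, with signs chosen as those of the coordinates of [v], span an orthant
    containing [v]. *)
Lemma generators_span v : exists2 f,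
  basis S f \in unitmx & forall i, 0 <= coord S f v 0 i.
Proof.
pose f := [ffun i => rshift (size s)
  (if 0 <= v 0 i then lshift d i else rshift d i)] : {ffun 'I_d -> _}.
have fE : basis S f = diag_mx (\row_i (if 0 <= v 0 i then delta else - delta)).
  apply/row_matrixP => i; rewrite row_basis ffunE rowKd row_diag_mx mxE.
  by case: ifP => _; rewrite ?rowKu ?rowKd row_scalar.
have fu : basis S f \in unitmx.
  rewrite fE unitmxE det_diag unitfE prodf_seq_neq0; apply/allP => i _.
  by rewrite mxE/=; case: ifP => _; rewrite ?oppr_eq0 gt_eqF.
exists f => // i.
suff /(coord_eq fu) -> : (\row_i (`|v 0 i| / delta)) *m basis S f = v.
  by rewrite mxE divr_ge0// ltW.
rewrite fE; apply/rowP => j; rewrite mul_mx_diag !mxE.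
case: ifP => v0; first by rewrite divfK ?gt_eqF// ger0_norm.
by rewrite mulrN divfK ?gt_eqF// ltr0_norm ?opprK// ltNge v0.
Qed.

End Vertices.

(** * Lattice points of a half-open simplicial cone *)

Section SimplexPoints.
Variables (d l m : nat).

(** The test [l <= m] is needed since the truncated [m - l] would otherwise be 0 and leave the zero
    vector. *)
Definition simplex_points : seq 'rV[nat]_d :=
  if (l <= m)%N then
    [seq \row_i (tnth t i : nat) |
      t : d.-tuple 'I_(m - l).+1 <-
        enum [pred t : d.-tuple 'I_(m - l).+1 | (\sum_(i <- t) i <= m - l)%N]]
  else [::].

Lemma mem_simplex_points r :
  (r \in simplex_points) = (\sum_i r 0%R i + l <= m)%N.
Proof.
rewrite /simplex_points; case: leqP => [lm|ml]; last first.
  by rewrite in_nil; apply/esym/negbTE; rewrite -ltnNge; lia.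
apply/mapP/idP => [[t + ->]|rm].
  rewrite mem_enum inE/= big_tuple => tm.
  by rewrite addnC -leq_subRL//; under eq_bigr do rewrite mxE.
have ri i : (r 0%R i < (m - l).+1)%N.
  by move: rm; rewrite (bigD1 i)//=; lia.
exists [tuple Ordinal (ri i) | i < d].
  rewrite mem_enum inE big_tuple leq_subRL// addnC.
  by under eq_bigr do rewrite tnth_mktuple.
by apply/rowP => i; rewrite mxE tnth_mktuple.
Qed.

Lemma simplex_points_uniq : uniq simplex_points.
Proof.
rewrite /simplex_points; case: leqP => // lm.
rewrite map_inj_uniq ?enum_uniq// => t u /rowP tu.
by apply: eq_from_tnth => i; apply: val_inj; have := tu i; rewrite !mxE.
Qed.

Lemma size_simplex_points : (l <= d)%N ->
  size simplex_points = 'C(m + d - l, d).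
Proof.
rewrite /simplex_points => ld; case: leqP => [lm|ml].
  rewrite size_map -cardE -(addnBAC _ lm) addnC -card_partial_ord_partitions.
  by apply: eq_card => t; rewrite !inE.
by rewrite bin_small//; lia.
Qed.

End SimplexPoints.

Section FractionalPart.
Context {R : realType}.
Implicit Types (c : bool) (a : R).

(** This is [[0, 1)] if [c] holds and [(0, 1]] otherwise: in both cases a fundamental domain for
    integer translations. *)
Definition unit_interval c a := (0 < a ?<= if c) && (a < 1 ?<= if ~~ c).

Lemma fractional_part c a : 0 < a ?<= if c ->
  exists n : nat, unit_interval c (a - n%:R).
Proof.
rewrite /unit_interval; case: c => /= a0.
  (* The integer part is the floor for [[0, 1)], and the ceiling minus one for [(0, 1]]. *)
  exists (Num.truncn a); have /andP[] := truncn_itv a0.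
  by rewrite subr_ge0 -natr1 ltrBlDl => -> ->.
have : 0 < Num.ceil a by rewrite ceil_gt0.
have /andP[] := ceil_itv a; rewrite intrB.
case: (Num.ceil a) => // -[|n] // a1 a2 _; exists n.
rewrite -[(_.+1)%:~R]/(n.+1%:R) -natr1 in a1 a2.
by rewrite subr_gt0 lerBlDl a2 andbT; lra.
Qed.

Lemma unit_interval_nat_inj c a a' (n n' : nat) :
  unit_interval c a -> unit_interval c a' -> a + n%:R = a' + n'%:R -> n = n'.
Proof.
move=> /andP[a0 a1] /andP[a'0 a'1] aa'.
suff /andP[] : (n < n'.+1)%N && (n' < n.+1)%N by lia.
by rewrite -!(ltr_nat R) -!natr1; case: c a0 a1 a'0 a'1 => /=; lra.
Qed.

Lemma unit_interval_reflect c a : unit_interval (~~ c) (1 - a) = unit_interval c a.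
Proof.
by rewrite /unit_interval negbK; case: c; rewrite /= ?subr_gt0 ?subr_ge0
  ?gerBl ?gtrBl andbC.
Qed.

Lemma unit_interval_ge0 c a : unit_interval c a -> 0 <= a.
Proof. by case/andP => /lteifW. Qed.

Lemma unit_interval_le1 c a : unit_interval c a -> a <= 1.
Proof. by case/andP => _ /lteifW. Qed.

End FractionalPart.

Section HalfOpenCone.
Context {R : realType} {d : nat}.
Variables (N : set 'rV[R]_d) (B : 'M[R]_d).
Hypothesis B_unit : B \in unitmx.
Hypothesis N0 : N 0.
Hypothesis NB : forall x y, N x -> N y -> N (x - y).
Hypothesis N_row : forall i, N (row i B).
Implicit Types (v x : 'rV[R]_d) (c : 'I_d -> bool) (k : rat) (r : 'rV[nat]_d).

Local Notation coordinates v := (v *m invmx B).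
Definition coord_sum v : R := \sum_i (v *m invmx B) 0 i.
Definition parallelepiped c v := [forall i, unit_interval (c i) ((v *m invmx B) 0 i)].
Definition shift r v : 'rV[R]_d := v + map_mx (fun j => j%:R) r *m B.

(** On [box c k] the truncated number is already a natural number, the [j] of that definition. *)
Definition level k x : nat := Num.truncn (coord_sum x - ratr k).

Definition box c k : set 'rV[R]_d :=
  [set x | [/\ N x, parallelepiped c x & exists j : nat, coord_sum x = ratr k + j%:R]].

Lemma subgroupD x y : N x -> N y -> N (x + y).
Proof. by move=> Nx Ny; have := NB Nx (NB N0 Ny); rewrite sub0r opprK. Qed.

Lemma subgroup_nat_comb r : N (map_mx (fun j => j%:R) r *m B).
Proof.
rewrite mulmx_sum_row; apply: (@big_ind _ N) => //; first exact: subgroupD.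
move=> i _; rewrite mxE scaler_nat; elim: (r 0%R i) => [|j IHj]; first by rewrite mulr0n.
by rewrite mulrSr; apply: subgroupD.
Qed.

Lemma coordinates_shift r v i :
  coordinates (shift r v) 0 i = coordinates v 0 i + (r 0%R i)%:R.
Proof.
rewrite /shift mulmxDl mulmxK//.
by rewrite [LHS]mxE; congr (_ + _); rewrite mxE.
Qed.

Lemma coord_sum_shift r v : coord_sum (shift r v) = coord_sum v + (\sum_i r 0%R i)%N%:R.
Proof.
by rewrite natr_sum -big_split/=; apply: eq_bigr => i _; rewrite coordinates_shift.
Qed.

Lemma levelE k x j : coord_sum x = ratr k + j%:R -> level k x = j.
Proof. by move=> xj; rewrite /level xj addrAC subrr add0r natrK. Qed.

(** The coordinates are at most 1 and [k > -1], so the level is less than [d + 1]. *)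
Lemma level_le c k x : -1 < k -> box c k x -> (level k x <= d)%N.
Proof.
move=> k1 [_ /forallP xbox [j xj]]; rewrite (levelE xj).
have xd : coord_sum x <= d%:R.
  have -> : d%:R = \sum_(i < d) 1 :> R by rewrite sumr_const card_ord.
  apply: ler_sum => i _.
  exact: unit_interval_le1 (xbox i).
have : (-1 : R) < ratr k by rewrite -(ltr_rat R) rmorphN1 in k1.
by rewrite -ltnS -(ltr_nat R) -natr1; lra.
Qed.

Definition cone_points c k m : seq 'rV[R]_d :=
  [seq shift r x | x <- fset_set (box c k),
                      r <- simplex_points d (level k x) m].

Hypothesis box_fin : forall c k, finite_set (box c k).

Lemma mem_cone_points c k m v : -1 < k <= 0 ->
  (v \in cone_points c k m) <->
  [/\ N v, [forall i, 0 < coordinates v 0 i ?<= if c i] &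
      exists2 i, (i <= m)%N & coord_sum v = ratr k + i%:R].
Proof.
move=> /andP[k1 k0]; split.
  move=> /allpairsPdep[x [r []]].
  rewrite in_fset_set// inE mem_simplex_points => -[Nx /forallP xbox [j xj]] + ->.
  rewrite (levelE xj) => jm; split.
  - by apply: subgroupD => //; exact: subgroup_nat_comb.
  - apply/forallP => i; rewrite coordinates_shift.
    have /andP[+ _] := xbox i; have := ler0n R (r 0%R i).
    by case: (c i) => /=; lra.
  - exists (\sum_i r 0%R i + j)%N => //.
    by rewrite coord_sum_shift xj -addrA -natrD addnC.
move=> [Nv /forallP vc [i im vi]].
(* Subtracting integer parts coordinatewise moves [v] into the parallelepiped. *)
have /choice[n nP] := fun j => fractional_part (vc j).
pose r : 'rV[nat]_d := \row_j n j.
pose x := v - map_mx (fun j => j%:R) r *m B.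
have vE : v = shift r x by rewrite /shift subrK.
have xbox j : unit_interval (c j) (coordinates x 0 j).
  suff -> : coordinates x 0 j = coordinates v 0 j - (n j)%:R by [].
  by rewrite [in RHS]vE coordinates_shift [r _ _]mxE addrK.
have x_ge0 : 0 <= coord_sum x.
  by apply: sumr_ge0 => j _; exact: unit_interval_ge0 (xbox j).
have vx : coord_sum v = coord_sum x + (\sum_j r 0%R j)%N%:R by rewrite {1}vE coord_sum_shift.
have {}k0 : ratr k <= 0 :> R by rewrite -(ler_rat R) rmorph0 in k0.
(* Since [coord_sum x >= 0] and [k <= 0], the remaining level [i - \sum_j r 0 j] is not
   truncated. *)
have ri : (\sum_j r 0%R j <= i)%N by rewrite -(ler_nat R); lra.
have xi : coord_sum x = ratr k + (i - \sum_j r 0%R j)%N%:R by rewrite natrB//; lra.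
apply/allpairsPdep; exists x, r; split => //; last first.
  by rewrite mem_simplex_points (levelE xi) subnKC.
rewrite in_fset_set// inE; split; last by exists (i - \sum_j r 0%R j)%N.
- by apply: NB => //; exact: subgroup_nat_comb.
- exact/forallP.
Qed.

Lemma cone_points_uniq c k m : uniq (cone_points c k m).
Proof.
apply: allpairs_uniq_dep => [|x _|]; first exact: fset_uniq.
  exact: simplex_points_uniq.
move=> _ _ /allpairsPdep[x [r [+ _ ->]]] /allpairsPdep[x' [r' [+ _ ->]]]/=.
rewrite !in_fset_set// !inE => -[_ /forallP xbox _] [_ /forallP xbox' _] xx'.
have rr' : r = r'.
  apply/rowP => i; apply: unit_interval_nat_inj (xbox i) (xbox' i) _.
  by rewrite -!coordinates_shift xx'.
by move: xx'; rewrite rr' => /addIr ->.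
Qed.

Lemma size_cone_points c k m : -1 < k ->
  size (cone_points c k m) =
  (\sum_(x <- fset_set (box c k)) 'C(m + d - level k x, d))%N.
Proof.
move=> k1; rewrite size_allpairs_dep sumnE big_map; apply: eq_big_seq => x.
rewrite in_fset_set// inE => xbox.
by rewrite size_simplex_points// (level_le k1 xbox).
Qed.

Definition box_reflect x : 'rV[R]_d := const_mx 1 *m B - x.

Lemma box_reflectK : involutive box_reflect.
Proof. by move=> x; rewrite /box_reflect subKr. Qed.

Lemma coordinates_reflect x i :
  coordinates (box_reflect x) 0 i = 1 - coordinates x 0 i.
Proof.
by rewrite /box_reflect mulmxBl mulmxK// [LHS]mxE [X in X + _]mxE; congr (_ + _); rewrite mxE.
Qed.

Lemma coord_sum_reflect x : coord_sum (box_reflect x) = d%:R - coord_sum x.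
Proof.
have -> : d%:R = \sum_(i < d) 1 :> R by rewrite sumr_const card_ord.
rewrite -sumrB; by apply: eq_bigr => i _; rewrite coordinates_reflect.
Qed.

(** From [d - (k + j) = (- e - k) + (d + e - j)]. The parameter [e] treats both cases of the
    reciprocity at once: 1 for [k < 0] and 0 for [k = 0]. *)
Lemma box_reflect_box c k (e : nat) x : -1 < k -> box c k x ->
  box (fun i => ~~ c i) (- e%:R - k) (box_reflect x) /\
  level (- e%:R - k) (box_reflect x) = (d + e - level k x)%N.
Proof.
move=> k1 xbox; have ld := level_le k1 xbox.
have [Nx /forallP xc [j xj]] := xbox; rewrite (levelE xj) in ld *.
have rx : coord_sum (box_reflect x) = ratr (- e%:R - k) + (d + e - j)%N%:R.
  rewrite coord_sum_reflect xj natrB ?(leq_trans ld) ?leq_addr// natrD rmorphB rmorphN/= ratr_nat.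
  by lra.
split; last exact: levelE.
split; last by exists (d + e - j)%N.
- apply: NB => //; have -> : const_mx 1 = map_mx (fun j => j%:R) (const_mx 1%N : 'rV_d) :> 'rV[R]_d.
    by apply/rowP => i; rewrite !mxE.
  exact: subgroup_nat_comb.
- by apply/forallP => i; rewrite coordinates_reflect unit_interval_reflect.
Qed.

Lemma sum_box_reflect (V : nmodType) (G : nat -> V) c k (e : nat) :
  -1 < k -> -1 < - e%:R - k ->
  \sum_(x <- fset_set (box c k)) G (level k x) =
  \sum_(x <- fset_set (box (fun i => ~~ c i) (- e%:R - k)))
    G (d + e - level (- e%:R - k) x)%N.
Proof.
move=> k1 k1'; pose k' := - e%:R - k.
have kk' : - e%:R - k' = k by rewrite /k' opprB addrC subrK.
have cc' : (fun i => ~~ ~~ c i) = c by apply/funext => i; rewrite negbK.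
have reflect_perm : perm_eq (fset_set (box (fun i => ~~ c i) k'))
    [seq box_reflect x | x <- fset_set (box c k)].
  apply: uniq_perm => [||x]; first exact: fset_uniq.
    by rewrite map_inj_uniq ?fset_uniq//; exact: inv_inj box_reflectK.
  rewrite in_fset_set//; apply/idP/mapP => [|[y + ->]].
    rewrite inE => /(box_reflect_box e k1')[+ _]; rewrite -/k' kk' cc' => xr.
    by exists (box_reflect x); rewrite ?box_reflectK// in_fset_set// inE.
  by rewrite in_fset_set// !inE => /(box_reflect_box e k1)[].
rewrite (perm_big _ reflect_perm) big_map; apply: eq_big_seq => x; rewrite in_fset_set// inE => xbox.
have [_ ->] := box_reflect_box e k1 xbox.
by rewrite subKn// (leq_trans (level_le k1 xbox))// leq_addr.
Qed.

End HalfOpenCone.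

(** * Lattices and the finiteness of their boxes *)

Section Lattice.
Context {R : realType} {d : nat}.
Variable N : set 'rV[R]_d.
Hypothesis latN : is_lattice N.

Lemma lattice0 : N 0.
Proof. by have [A _ ->] := latN; exists 0 => //; rewrite map_mx0 mul0mx. Qed.

Lemma latticeB x y : N x -> N y -> N (x - y).
Proof.
have [A _ ->] := latN => -[z _ <-] [z' _ <-].
by exists (z - z') => //; rewrite map_mxB mulmxBl.
Qed.

(** A box point has coordinates in [[0, 1]] on [B], and [B] is an integer matrix [Z] times the
    lattice basis, so its integer coordinates are bounded through the entries of [Z]. *)
Lemma lattice_box_finite (B : 'M[R]_d) c k : B \in unitmx ->
  (forall i, N (row i B)) -> finite_set (box N B c k).
Proof.
have [A A_unit NE] := latN => B_unit N_row.
have /choice[z zP] : forall i, exists z : 'rV[int]_d, map_mx intr z *m A = row i B.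
  by move=> i; have := N_row i; rewrite NE => -[z _ zB]; exists z.
pose Z : 'M[int]_d := \matrix_(i, j) z i 0 j.
have BE : B = map_mx intr Z *m A.
  apply/row_matrixP => i; rewrite -zP row_mul; congr (_ *m _).
  by apply/rowP => j; rewrite !mxE.
pose M := (\sum_i \sum_j `|Z i j|)%N.
(* Integers between [-M] and [M] are encoded as ordinals through a shift by [M]. *)
pose g (u : {ffun 'I_d -> 'I_(M + M).+1}) : 'rV[R]_d :=
  map_mx intr (\row_j ((u j : nat)%:Z - M%:Z)) *m A.
apply: (@sub_finite_set _ _ (g @` setT)); last first.
  by apply: finite_image; exact: finite_finset.
move=> x [Nx /forallP xB _]; move: Nx; rewrite NE => -[y _ yx].
have yE : map_mx intr y = x *m invmx B *m map_mx intr Z.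
  apply: (can_inj (mulmxK A_unit)).
  by rewrite -[RHS]mulmxA -BE mulmxKV.
have yM j : `|y 0 j| <= M%:Z.
  rewrite -(ler_int R) intr_norm.
  have -> : (y 0 j)%:~R = (map_mx intr y) 0 j :> R by rewrite mxE.
  rewrite yE mxE; apply: le_trans (ler_norm_sum _ _ _) _.
  rewrite -[M%:~R]/(M%:R) natr_sum; apply: ler_sum => i _.
  rewrite normrM (bigD1 j)//= natrD.
  have /unit_interval_ge0 a0 := xB i; have /unit_interval_le1 a1 := xB i.
  apply: le_trans (_ : `|Z i j|%N%:R <= _); last by rewrite lerDl.
  rewrite [map_mx _ _ i j]mxE -intr_norm ger0_norm// -[leRHS]mul1r.
  by rewrite ler_pM.
exists [ffun j => inord (absz (y 0 j + M%:Z))] => //; rewrite /g -yx.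
congr (map_mx _ _ *m _); apply/rowP => j; rewrite mxE ffunE inordK.
  by have := yM j; lia.
by have := yM j; lia.
Qed.

End Lattice.

(** Double counting of the incidences [h i v]. As [K > 0], every point of [V] is in some list, so
    [V] is finite and [fset_set] is faithful. *)
Lemma sum_size_cover (T : choiceType) (I : finType) (D : pred I) (V : set T)
    (h : I -> T -> bool) (L : I -> seq T) (K : nat) : (0 < K)%N ->
  (forall v, V v -> (\sum_(i | D i) h i v = K)%N) ->
  (forall i, D i -> uniq (L i)) ->
  (forall i v, D i -> v \in L i <-> V v /\ h i v) ->
  (\sum_(i | D i) size (L i) = K * #|` fset_set V|)%N.
Proof.
move=> K0 VK uniqL memL.
have finV : finite_set V.
  apply: (@sub_finite_set _ _ [set` flatten [seq L i | i <- enum D]]); last first.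
    exact: finite_seq.
  move=> v Vv; move: K0; rewrite -(VK v Vv) lt0n sum_nat_eq0 => /forallPn[i].
  rewrite negb_imply eqb0 negbK => /andP[Di hiv].
  by apply/flatten_mapP; exists i; [rewrite mem_enum | apply/memL].
rewrite card_fset_sum1 big_distrr/=.
transitivity (\sum_(v <- fset_set V) \sum_(i | D i) h i v)%N; last first.
  by apply: eq_big_seq => v; rewrite in_fset_set// inE muln1 => /VK.
rewrite exchange_big/=; apply: eq_bigr => i Di.
transitivity (size [seq v <- fset_set V | h i v]).
  apply/perm_size/uniq_perm; [exact: uniqL|exact/filter_uniq/fset_uniq|move=> v].
  rewrite mem_filter in_fset_set//; apply/idP/andP => [/memL[]//|[hv]].
    by move=> Vv hv; rewrite inE.
  by rewrite inE => Vv; apply/memL.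
rewrite size_filter -sum1_count big_mkcond; apply: eq_bigr => v _.
by case: (h i v).
Qed.

(** * Binomial coefficients as polynomials and their reciprocity *)

Section BinomialPolynomial.
Variable d : nat.

(** The binomial coefficient ['C(X + d - j, d)] as a polynomial in [X]. *)
Definition binomial_poly (j : nat) : {poly rat} :=
  (d`!%:R)^-1 *: \prod_(i < d) ('X - (j%:R + i%:R - d%:R)%:P).

Lemma size_binomial_poly j : (size (binomial_poly j) <= d.+1)%N.
Proof.
apply: leq_trans (size_scale_leq _ _) _.
by rewrite size_prod_XsubC -sum1_size sum_nat_const card_ord muln1.
Qed.

Lemma horner_binomial_poly j x :
  (binomial_poly j).[x] = (d`!%:R)^-1 * \prod_(i < d) (x + d%:R - j%:R - i%:R).
Proof.
rewrite hornerZ horner_prod; congr (_ * _); apply: eq_bigr => i _.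
by rewrite hornerXsubC; ring.
Qed.

Lemma prod_sub_ffact (n : nat) e :
  \prod_(i < e) (n%:R - i%:R) = (n ^_ e)%:R :> rat.
Proof.
elim: e => [|e IHe]; first by rewrite big_ord0 ffactn0.
rewrite big_ord_recr/= IHe ffactnSr natrM.
by have [en|ne] := leqP e n; [rewrite natrB | rewrite ffact_small// !mul0r].
Qed.

Lemma binomial_poly_nat j (m : nat) : (j <= d)%N ->
  (binomial_poly j).[m%:R] = 'C(m + d - j, d)%:R.
Proof.
move=> jd; rewrite horner_binomial_poly.
have -> : m%:R + d%:R - j%:R = (m + d - j)%:R :> rat.
  by rewrite natrB ?natrD//; lia.
by rewrite prod_sub_ffact -bin_ffact natrM mulrC mulfK.
Qed.

(** Reversing the product on the right matches its factors with the opposites of those on the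
    left. *)
Lemma binomial_poly_reciprocity j (e : nat) x : (j <= d + e)%N ->
  (binomial_poly j).[x] = (-1) ^+ d * (binomial_poly (d + e - j)).[e%:R - 1 - x].
Proof.
move=> jd; rewrite !horner_binomial_poly mulrCA; congr (_ * _).
rewrite -[in (-1) ^+ d](card_ord d) -prodr_const -big_split/=.
rewrite (reindex_inj rev_ord_inj); apply: eq_bigr => i _ /=.
by rewrite !natrB// natrD -natr1; ring.
Qed.

End BinomialPolynomial.

(** * The counting polynomial and its reciprocity *)

Section EhrhartPolynomial.
Context {R : realType} {n d : nat}.
Variables (N : set 'rV[R]_d) (S : 'M[R]_(n, d)) (w : 'I_n -> R).
Implicit Types (q : 'rV[R]_d) (k : rat) (f : {ffun 'I_d -> 'I_n}).

Definition closed_facets q f (i : 'I_d) : bool := 0 < coord S f q 0 i.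

(** The division by the factorial compensates for the orderings of each basis. *)
Definition ehrhart_poly q k : {poly rat} := (d`!%:R)^-1 *:
  \sum_(f | dual_feasible S w f)
    \sum_(x <- fset_set (box N (basis S f) (closed_facets q f) k))
      binomial_poly d (level (basis S f) k x).

Lemma size_ehrhart_poly q k : (size (ehrhart_poly q k) <= d.+1)%N.
Proof.
apply: leq_trans (size_scale_leq _ _) _.
have sizeD (p r : {poly rat}) : (size p <= d.+1)%N -> (size r <= d.+1)%N ->
    (size (p + r)%R <= d.+1)%N.
  by move=> pd rd; rewrite (leq_trans (size_polyD _ _))// geq_max pd.
do 2![apply: (big_ind (fun p : {poly rat} => size p <= d.+1)%N);
  [by rewrite size_poly0|exact: sizeD|move=> ? _]].
exact: size_binomial_poly.
Qed.

Lemma genericN q : generic S q -> generic S (- q).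
Proof.
by move=> qg f i fu; rewrite -scaleN1r coordZ scaleN1r mxE oppr_eq0 qg.
Qed.

Lemma closed_facetsN q f : generic S q -> basis S f \in unitmx ->
  closed_facets (- q) f = (fun i => ~~ closed_facets q f i).
Proof.
move=> qg fu; apply/funext => i.
rewrite /closed_facets -scaleN1r coordZ scaleN1r mxE oppr_gt0.
by rewrite -leNgt le_eqVlt (negbTE (qg f i fu)).
Qed.

Hypothesis N0 : N 0.
Hypothesis NB : forall x y, N x -> N y -> N (x - y).
Hypothesis N_basis : forall f i, dual_feasible S w f -> N (row i (basis S f)).
Hypothesis box_finite : forall f c k, dual_feasible S w f ->
  finite_set (box N (basis S f) c k).

(** Box reflection and binomial reciprocity are applied cone by cone; reflection complements the
    closed facets, which amounts to replacing [q] by [- q]. *)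
Lemma ehrhart_poly_reciprocity q k (e : nat) x : generic S q ->
  -1 < k -> -1 < - e%:R - k ->
  (ehrhart_poly q k).[x] =
  (-1) ^+ d * (ehrhart_poly (- q) (- e%:R - k)).[e%:R - 1 - x].
Proof.
move=> qg k1 k1'; rewrite !hornerZ mulrCA; congr (_ * _).
rewrite !horner_sum mulr_sumr; apply: eq_bigr => f fP.
have fu : basis S f \in unitmx by case/andP: fP.
rewrite !horner_sum mulr_sumr (closed_facetsN qg fu).
pose G j := (binomial_poly d j).[x].
rewrite (sum_box_reflect fu N0 NB (fun i => N_basis i fP) _ G _ k1 k1'); last first.
  by move=> c k'; exact: box_finite.
apply: eq_big_seq => y; rewrite in_fset_set ?inE; last exact: box_finite.
move=> ybox; have ld := level_le k1' ybox.
rewrite /G (@binomial_poly_reciprocity _ _ e); last by rewrite leq_subr.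
by rewrite subKn// (leq_trans ld)// leq_addr.
Qed.

End EhrhartPolynomial.

(** * Counting and reciprocity for the polytope *)

Theorem theorem5p1 (R : realType) (d : nat) (N P : set 'rV[R]_d)
    (latN : is_lattice N) (polyP : lattice_polytope N P)
    (dimP : full_dimensional P) (P0 : P° 0) :
  exists F : rat -> {poly rat},
    (forall k : rat, -1 < k <= 0 ->
       (size (F k) <= d.+1)%N /\
       (forall m : nat, (F k).[m%:R] = (f0 N P k m)%:R)) /\
    (forall (k : rat) (m : nat), -1 < k <= 0 -> (0 < m)%N ->
       (F k).[- m%:R] =
         if k < 0 then (-1) ^+ d * (F (-1 - k)).[m%:R]
         else (-1) ^+ d * (F k).[m%:R - 1]).
Proof.
have [s sN PE] := polyP; rewrite PE in P0 * => {PE polyP dimP P}.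
have [delta delta0 deltaP] := conv_hull_ball P0.
have {}P0 : conv_hull s 0 by exact: nbhs_singleton P0.
pose S := generators s (delta / 2).
have d2 : 0 < delta / 2 by rewrite divr_gt0.
have {}deltaP i : conv_hull s ((2 * (delta / 2)) *: delta_mx 0 i) /\
    conv_hull s (- ((2 * (delta / 2)) *: delta_mx 0 i)).
  by rewrite mulrC divfK//; exact: deltaP.
have [w [w_gt0 wtf w1]] := exists_tie_free_weights S.
have [q qg] := exists_generic S.
have N0 := lattice0 latN; have NB := latticeB latN.
have N_basis f i : dual_feasible S w f -> N (row i (basis S f)).
  move=> /w1 f1; have [k fk] := feasible_vertex deltaP i f1.
  by rewrite row_basis fk; apply: sN; rewrite /= mem_nth.
have box_finite f c k : dual_feasible S w f -> finite_set (box N (basis S f) c k).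
  move=> fP; apply: lattice_box_finite => //; first by case/andP: fP.
  by move=> i; exact: N_basis.
(* Stated for every generic direction: the polynomials of [q] and [- q] count the same points, so
   reciprocity can return to the polynomial of [q]. *)
have evalE p k (m : nat) : generic S p -> -1 < k <= 0 ->
    (ehrhart_poly N S w p k).[m%:R] = (f0 N (conv_hull s) k m)%:R.
  move=> pg k01; have /andP[k1 k0] := k01.
  pose L f := cone_points N (basis S f) (closed_facets S p f) k m.
  have basis_unit f : dual_feasible S w f -> basis S f \in unitmx by case/andP.
  have := @sum_size_cover _ _ (dual_feasible S w)
    [set v | [/\ dilate m%:R (conv_hull s) v, N v & w0 (conv_hull s) v = ratr k]]
    (fun f v => half_open S f (closed_facets S p f) v) L d`! (fact_gt0 d).
  rewrite -/(f0 N (conv_hull s) k m) => cover.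
  have fact_neq0 : d`!%:R != 0 :> rat by rewrite pnatr_eq0 -lt0n fact_gt0.
  apply: (mulfI fact_neq0); rewrite hornerZ mulrA divff// mul1r -natrM -cover; first last.
  - move=> f v fP; split.
      move=> /(mem_cone_points (basis_unit f fP) N0 NB (fun i => N_basis f i fP)
        (fun c k => box_finite f c k fP) _ _ _ k01)[Nv vf vk].
      have vf0 i : 0 <= coord S f v 0 i by move/forallP: vf => /(_ i)/lteifW.
      by have [] := (dilate_w0_cone P0 deltaP m (w1 f fP) vf0 k01).2 vk.
    move=> [[mv Nv vk] vf].
    have vf0 i : 0 <= coord S f v 0 i by move/forallP: vf => /(_ i)/lteifW.
    apply/(mem_cone_points (basis_unit f fP) N0 NB (fun i => N_basis f i fP)
        (fun c k => box_finite f c k fP) _ _ _ k01); split => //.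
    exact/(dilate_w0_cone P0 deltaP m (w1 f fP) vf0 k01).
  - move=> f fP; apply: cone_points_uniq; first exact: basis_unit.
    by move=> c k'; exact: box_finite.
  - move=> v _; apply: card_half_open => // y.
    exact: generators_span.
  rewrite horner_sum natr_sum; apply: eq_bigr => f fP.
  have fu := basis_unit f fP.
  rewrite size_cone_points//; last by move=> c k'; exact: box_finite.
  rewrite horner_sum natr_sum; apply: eq_big_seq => x.
  rewrite in_fset_set ?inE; last exact: box_finite.
  by move=> xbox; rewrite binomial_poly_nat// (level_le k1 xbox).
exists (ehrhart_poly N S w q); split=> [k k01|k m k01 m0].
  by split; [exact: size_ehrhart_poly | move=> m; exact: evalE].
have /andP[k1 k0] := k01.
have q'g := genericN qg.
have reciprocity := ehrhart_poly_reciprocity N0 NB N_basis box_finite.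
case: ifP => kn0.
  have k'01 : -1 < -1 - k <= 0 by apply/andP; split; lra.
  (* With [e = 1] the argument [e - 1 - x] at [x = - m] is [m]. *)
  rewrite (reciprocity _ _ 1%N)//; last by case/andP: k'01.
  by rewrite subrr sub0r opprK !evalE.
have {k0 k1 kn0} -> : k = 0 by apply/eqP; rewrite eq_le k0 leNgt kn0.
have reflect0 : - 0%:R - 0 = 0 :> rat by rewrite subr0 oppr0.
(* With [e = 0] the argument is [m - 1], a natural number since [m > 0], so [evalE] applies to both
   directions. *)
rewrite (reciprocity _ _ 0%N) ?reflect0 ?ltrN10//.
case: m m0 => // m _; rewrite mulr0n sub0r opprK addrC -natr1 addrK.
by rewrite !evalE ?lexx ?ltrN10.
Qed.
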